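(* Let $n=3\cdot 2^k$ or $n=2^k$ for some integer $k\ge 1$. Then for every $f\in L_2^+(\mathbb{Z}_n,\mu_n)$, $$\int_{\mathbb{Z}_n} f^2\log f^2\,d\mu_n-\|f\|_2^2\log\|f\|_2^2\le 2\langle f,A_{\psi_n}f\rangle_{L_2(\mathbb{Z}_n,\mu_n)},$$ and the constant $2$ is optimal (it cannot be replaced by any smaller constant so that the inequality still holds for all $f\in L_2^+(\mathbb{Z}_n,\mu_n)$).
   Context: $\mathbb{Z}_n=\{0,1,\dots,n-1\}$ is the cyclic group of order $n$, equipped with the normalized counting measure $\mu_n$ (each point has mass $1/n$). $L_2^+(\mathbb{Z}_n,\mu_n)$ is the set of nonnegative real-valued functions on $\mathbb{Z}_n$; $\|f\|_2^2=\frac1n\sum_x |f(x)|^2$ and $\langle\cdot,\cdot\rangle_{L_2(\mathbb{Z}_n,\mu_n)}$ is the corresponding inner product. The convention $0\log 0=0$ is used. For $0\le k\le n-1$, $\chi_k(x)=e^{2\pi i kx/n}$. The word-length function is $\psi_n(k)=\min(k,n-k)$ for $0\le k\le n-1$, and $$A_{\psi_n}\Big(\sum_{k=0}^{n-1}a_k\chi_k\Big)=\sum_{k=0}^{n-1}\psi_n(k)a_k\chi_k .$$ *)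

(* Defs.v *)
From HB Require Import structures.
From mathcomp Require Import all_boot all_order all_algebra.
From mathcomp Require Import complex reals exp trigo.
From mathcomp Require Import ring lra.

Set Implicit Arguments.
Unset Strict Implicit.
Unset Printing Implicit Defensive.

Import Order.TTheory GRing.Theory Num.Theory.
Local Open Scope ring_scope.
Local Open Scope complex_scope.

(* Z_n is represented by its set of representatives 'I_n = {0, ..., n-1}, so
   functions on Z_n are plain functions on 'I_n.  The group law enters only
   through the characters. *)

(* Integral against the normalized counting measure; F is R or R[i]. *)
Definition avg (F : fieldType) (n : nat) (f : 'I_n -> F) : F :=
  \sum_(x < n) f x * n%:R^-1.

Definition normsq (R : realType) (n : nat) (f : 'I_n -> R) : R :=
  avg (fun x => `|f x| ^+ 2).

(* The library's ln is total, so 0 * ln 0 = 0 as required by the convention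
   0 log 0 = 0. *)
Definition entsq (R : realType) (n : nat) (f : 'I_n -> R) : R :=
  avg (fun x => f x ^+ 2 * ln (f x ^+ 2)) - normsq f * ln (normsq f).

Definition inner (R : realType) (n : nat) (f g : 'I_n -> R[i]) : R[i] :=
  avg (fun x => f x * (g x)^*%C).

Definition cis (R : realType) (t : R) : R[i] := cos t +i* sin t.

Definition chi (R : realType) (n : nat) (k x : 'I_n) : R[i] :=
  cis (2 * pi * k%:R * x%:R / n%:R).

Definition word_length (n : nat) (k : 'I_n) : nat := minn k (n - k).

(* The coefficient of chi_k in f is <f, chi_k>; see Apsi_sum and chi_expansion
   below: Apsi is the linear operator with Apsi chi_k = psi_n(k) chi_k. *)
Definition Apsi (R : realType) (n : nat) (f : 'I_n -> R[i]) : 'I_n -> R[i] :=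
  fun x => \sum_(k < n) (word_length k)%:R * inner f (chi R k) * chi R k x.

Definition toC (R : realType) (n : nat) (f : 'I_n -> R) : 'I_n -> R[i] :=
  fun x => (f x)%:C.

(* The comparison is in the partial order of R[i] (equal imaginary parts and
   comparable real parts).  The right-hand side is real by inner_Apsi_real, so
   this is the inequality between real numbers. *)
Definition log_sobolev (R : realType) (n : nat) (c : R) : Prop :=
  forall f : 'I_n -> R, (forall x, 0 <= f x) ->
    (entsq f)%:C <= c%:C * inner (toC f) (Apsi (toC f)).

Section Facts.
Variable R : realType.

Lemma cisD (s t : R) : cis (s + t) = cis s * cis t.
Proof. by rewrite /cis sinD cosD; simpc; congr (_ +i* _); rewrite addrC. Qed.

Lemma cis0 : cis (0 : R) = 1.
Proof. by rewrite /cis cos0 sin0. Qed.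

Lemma cisM_nat (t : R) (m : nat) : cis (t * m%:R) = cis t ^+ m.
Proof.
elim: m => [|m IH]; first by rewrite mulr0 cis0 expr0.
by rewrite exprSr -IH -cisD -natr1 mulrDr mulr1.
Qed.

Lemma cisJ (t : R) : (cis t)^* = cis (- t).
Proof. by rewrite /cis /= cosN sinN. Qed.

Lemma cis2pi : cis (2 * pi : R) = 1.
Proof. by rewrite mulr_natl /cis cos2pi sin2pi. Qed.

Lemma cis_neq1 (t : R) : 0 < t < 2 * pi -> cis t != 1.
Proof.
move=> /andP[t0 t2]; have s0 : 0 < sin (t / 2).
  by apply: sin_gt0_pi; apply/andP; split; lra.
apply/eqP => -[]; have -> : t = t / 2 + t / 2 by lra.
rewrite cosD => c1 _; have := cos2Dsin2 (t / 2).
have : 0 < sin (t / 2) * sin (t / 2) by apply: mulr_gt0.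
rewrite !expr2; lra.
Qed.

Lemma chiC n (k x : 'I_n) : chi R k x = chi R x k.
Proof. by rewrite /chi -[2 * pi * _ * _]mulrA [k%:R * _]mulrC !mulrA. Qed.

Lemma chi_orthonormal n (k l : 'I_n) :
  inner (chi R k) (chi R l) = (k == l)%:R.
Proof.
have n0 : (0 < n)%N by apply: leq_ltn_trans (ltn_ord k).
have nR : n%:R != 0 :> R by rewrite pnatr_eq0 -lt0n.
have nC : n%:R != 0 :> R[i] by rewrite pnatr_eq0 -lt0n.
set t := 2 * pi * (k%:R - l%:R) / n%:R : R.
have E : inner (chi R k) (chi R l) = (\sum_(x < n) cis t ^+ x) * n%:R^-1.
  rewrite /inner /avg mulr_suml; apply: eq_bigr => x _; congr (_ * _).
  by rewrite /chi cisJ -cisD -cisM_nat; congr cis; rewrite /t; field.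
rewrite E {E}; case: eqVneq => [kl|kl].
  rewrite /t kl subrr mulr0 mul0r cis0.
  under eq_bigr do rewrite expr1n.
  by rewrite sumr_const card_ord mulfV.
have zn : cis t ^+ n = 1.
  have -> : cis t ^+ n = cis (2 * pi * k%:R : R) * (cis (2 * pi * l%:R : R))^*%C.
    by rewrite cisJ -cisD -cisM_nat; congr cis; rewrite /t; field.
  by rewrite !cisM_nat cis2pi !expr1n conjc1 mulr1.
suff z1 : cis t != 1.
  have := subrX1 (cis t) n; rewrite zn subrr => /esym/eqP.
  by rewrite mulf_eq0 subr_eq0 (negPf z1) /= => /eqP->; rewrite mul0r.
have key (a b : 'I_n) : (a < b)%N ->
    cis (2 * pi * (b%:R - a%:R) / n%:R : R) != 1.
  move=> ab; have p0 := pi_gt0 R.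
  have nR0 : 0 < n%:R :> R by rewrite ltr0n.
  have ab' : a%:R < b%:R :> R by rewrite ltr_nat.
  have a0 : 0 <= a%:R :> R by [].
  have bn : b%:R < n%:R :> R by rewrite ltr_nat.
  have d0 : 0 < (b%:R - a%:R) / n%:R :> R by rewrite divr_gt0 // subr_gt0.
  have d1 : (b%:R - a%:R) / n%:R < 1 :> R by rewrite ltr_pdivrMr //; lra.
  have p2 : 0 < 2 * pi :> R by rewrite mulr_gt0.
  apply: cis_neq1; rewrite -mulrA; apply/andP; split; first exact: mulr_gt0.
  by rewrite gtr_pMr.
case: (ltngtP k l) => [lt_kl|lt_lk|/val_inj/eqP]; last by rewrite (negPf kl).
- apply: contra (key _ _ lt_kl) => /eqP z1; apply/eqP.
  by rewrite -[RHS]conjc1 -z1 cisJ; congr cis; rewrite /t; field.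
- exact: key.
Qed.

Lemma Apsi_sum n (a : 'I_n -> R[i]) (x : 'I_n) :
  Apsi (fun y => \sum_(k < n) a k * chi R k y) x
  = \sum_(k < n) (word_length k)%:R * a k * chi R k x.
Proof.
rewrite /Apsi; apply: eq_bigr => k _; congr (_ * _ * _).
have -> : inner (fun y => \sum_(j < n) a j * chi R j y) (chi R k)
        = \sum_(j < n) a j * inner (chi R j) (chi R k).
  rewrite /inner /avg.
  under [RHS]eq_bigr do rewrite mulr_sumr.
  rewrite exchange_big /=; apply: eq_bigr => y _.
  by rewrite !mulr_suml; apply: eq_bigr => j _; rewrite !mulrA.
rewrite (bigD1 k) //= chi_orthonormal eqxx mulr1 big1 ?addr0 // => j jk.
by rewrite chi_orthonormal (negPf jk) mulr0.
Qed.

Lemma chi_expansion n (f : 'I_n -> R[i]) (x : 'I_n) :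
  f x = \sum_(k < n) inner f (chi R k) * chi R k x.
Proof.
have -> : \sum_(k < n) inner f (chi R k) * chi R k x
        = \sum_(y < n) f y * inner (chi R x) (chi R y).
  under eq_bigr do rewrite /inner /avg mulr_suml.
  rewrite exchange_big; apply: eq_bigr => y _.
  rewrite /inner /avg mulr_sumr; apply: eq_bigr => k _.
  by rewrite (chiC x k) (chiC y k); ring.
rewrite (bigD1 x) //= chi_orthonormal eqxx mulr1 big1 ?addr0 // => y yx.
by rewrite chi_orthonormal eq_sym (negPf yx) mulr0.
Qed.

Lemma inner_Apsi n (f : 'I_n -> R[i]) :
  inner f (Apsi f)
  = \sum_(k < n) (word_length k)%:R * `|inner f (chi R k)| ^+ 2.
Proof.
transitivity (\sum_(k < n) (word_length k)%:R * (inner f (chi R k))^*%C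
                * inner f (chi R k)); last first.
  by apply: eq_bigr => k _; rewrite sqr_normc -mulrA [_^* * _]mulrC.
rewrite {1}/inner /avg.
under eq_bigr => x _.
  rewrite /Apsi rmorph_sum mulr_sumr mulr_suml.
  over.
rewrite exchange_big; apply: eq_bigr => k _.
rewrite [X in _ = _ * X]/inner /avg [RHS]mulr_sumr; apply: eq_bigr => x _.
by rewrite !(rmorphM (@conjc _)) rmorph_nat; ring.
Qed.

Lemma inner_Apsi_real n (f : 'I_n -> R[i]) :
  inner f (Apsi f) \is Num.real.
Proof.
rewrite inner_Apsi; apply: rpred_sum => k _.
by apply: ger0_real; rewrite mulr_ge0 // exprn_ge0.
Qed.

End Facts.

(* Main.v *)
Require Import Defs.
From mathcomp Require Import all_boot all_order all_algebra.
From mathcomp Require Import complex reals exp trigo.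
From mathcomp Require Import classical_sets topology normedtype.
From mathcomp Require Import sequences derive realfun.
From mathcomp Require Import zify ring lra.

(** The inequality and its optimality hold on Z_n for every even n; the proof
    is a direct one, by a cubic majorant of the entropy and a count of the
    resonant triples of frequencies.

    Let N be the L2 norm of f.  For y >= 0 the function y^2 ln y^2 lies below its
    Taylor polynomial of order 3 at y = 1 (sqr_ln_upper).  Taking y = f(x)/N and
    averaging bounds the entropy of f^2 by a polynomial in N, the mean m of f
    and the averages of t^2 and t^3, where t = f - m (entsq_le).

    With b_k the modulus of the k-th Fourier coefficient of t, the average of
    t^3 is at most the sum of b_i b_j b_k over the triples with n | i + j + k
    (avg_cube_le).  All three frequencies being nonzero, two of them lie in the
    same open half ]0, n/2[ or ]n/2, n[ (same_arc_triple), so up to a factor 3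
    one may impose this on (i, j).  Then
      2 b_i b_j b_k <= b_i^2 b_j^2 / N + N b_k^2,
    and the number of pairs (i, j) that go with a given k is 2 (psi_n(k) - 1)
    (count_same_arc).  This is where the word length comes from: the right-hand
    side adds up to the variance squared over 2N plus twice N times the excess
    of the energy <f, A f> over the variance (triple_sum_le).  Inserted in the
    cubic bound, what remains is the polynomial inequality
    (N - m)^3 (N + 3 m) >= 0, true since 0 <= m <= N.

    The constant is optimal because the frequencies of word length 1 have
    eigenvalue 1: for f = 1 + e cos(2 pi x / n) both 2 <f, A f> and the entropy
    are 2 e^2 v up to O(e^3), where v is the average of the squared cosine.
    The lower bound for the entropy needed there is the same cubic bound on the
    logarithm, read at 1/y (sqr_ln_lower). *)

Set Implicit Arguments.
Unset Strict Implicit.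
Unset Printing Implicit Defensive.

Import Order.TTheory GRing.Theory Num.Theory.
Import numFieldNormedType.Exports.
Local Open Scope classical_set_scope.
Local Open Scope complex_scope.
Local Open Scope ring_scope.

(** * Cubic bounds for the logarithm *)

(** The two sides agree at s = 0, and the derivative of their difference is
    (2/3) exp(-2s) (exp(s) - 1)^3, which has the sign of s. *)
Lemma exp_cubic_bound (R : realType) (s : R) :
  2 * s <= 2 / 3 * expR s + 1 - 2 * expR (- s) + 1 / 3 * expR (- s) ^+ 2.
Proof.
pose F s : R := 2 / 3 * expR s + 1 - 2 * expR (- s) + 1 / 3 * expR (- s) ^+ 2 - 2 * s.
pose dF s : R := 2 / 3 * expR (- s) ^+ 2 * (expR s - 1) ^+ 3.
have ee c : expR c * expR (- c) = 1 :> R by rewrite expRxMexpNx_1.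
have dFE (c : R) : is_derive c 1 F (dF c).
  apply: is_derive_eq; rewrite /dF /GRing.scale /= .
  have e1 := ee c.
  have : expR c = (expR (- c))^-1 by rewrite expRN invrK.
  have := expR_gt0 (-c); move: (expR (- c)) => u u0 ->; field; lra.
have cF (a b : R) : {within `[a, b]%classic, continuous F}.
  apply: continuous_subspaceT => c; apply: differentiable_continuous.
  by apply/derivable1_diffP; apply: ex_derive.
suff: F 0 <= F s by rewrite /F oppr0 expR0; lra.
have F_increment c : 0 <= (expR c - 1) * s -> 0 <= dF c * s.
  move=> cs; have -> : dF c * s
      = 2 / 3 * (expR (- c) ^+ 2 * (expR c - 1) ^+ 2 * ((expR c - 1) * s)).
    by rewrite /dF; ring.
  by apply: mulr_ge0; [lra|apply: mulr_ge0; rewrite // mulr_ge0 ?sqr_ge0].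
rewrite -subr_ge0; have [s0|/ltW s0] := leP 0 s.
- have [c] := MVT_segment s0 (fun x _ => dFE x) (cF _ _).
  rewrite in_itv /= => /andP[c0 _] ->; rewrite subr0 F_increment // mulr_ge0 //.
  by rewrite subr_ge0 -expR0 ler_expR.
- have [c] := MVT_segment s0 (fun x _ => dFE x) (cF _ _).
  rewrite in_itv /= sub0r => /andP[_ c0] dF_eq.
  rewrite -opprB dF_eq mulrN opprK F_increment // mulr_le0 //.
  by rewrite subr_le0 -expR0 ler_expR.
Qed.

Lemma ln_cubic_upper (R : realType) (y : R) : 0 < y ->
  2 * ln y <= 2 / 3 * y + 1 - 2 / y + 1 / 3 / y ^+ 2.
Proof.
move=> y0; have := @exp_cubic_bound R (ln y).
by rewrite expRN lnK ?posrE // exprVn.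
Qed.

(** Up to the factor N^2, this is the Taylor polynomial of order 3 of
    y^2 ln y^2 at y = 1, for y = x / N. *)
Lemma sqr_ln_upper (R : realType) (N x : R) : 0 < N -> 0 <= x ->
  x ^+ 2 * ln (x ^+ 2) - x ^+ 2 * ln (N ^+ 2)
  <= 2 / 3 * x ^+ 3 / N + x ^+ 2 - 2 * x * N + N ^+ 2 / 3.
Proof.
move=> N0; rewrite le_eqVlt => /orP[/eqP <-|x0].
  by have := sqr_ge0 N; rewrite !(expr0n, mul0r, mulr0) /=; lra.
have x20 : 0 < x ^+ 2 by rewrite exprn_gt0.
rewrite -mulrBr -ln_div ?posrE ?exprn_gt0 // -expr_div_n lnXn ?divr_gt0 //.
rewrite -[ln _ *+ 2]mulr_natl; have H := @ln_cubic_upper R _ (divr_gt0 x0 N0).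
apply: le_trans (ler_wpM2l (ltW x20) H) _.
rewrite le_eqVlt; apply/orP; left; apply/eqP; field; lra.
Qed.

(** The bound on ln y used at y = 1 / (1 + t): it has the right Taylor
    expansion at t = 0 up to order 3. *)
Lemma sqr_ln_lower (R : realType) (t : R) : -1 < t ->
  2 * t + 3 * t ^+ 2 + 2 / 3 * t ^+ 3 - t ^+ 4 / 3
  <= (1 + t) ^+ 2 * ln ((1 + t) ^+ 2).
Proof.
move=> t1; have y0 : 0 < 1 + t by lra.
have yi0 : 0 < (1 + t)^-1 by rewrite invr_gt0.
have := @ln_cubic_upper R _ yi0; rewrite lnV ?posrE // exprVn !invrK.
move/(ler_wpM2l (ltW (exprn_gt0 2 y0))); rewrite lnXn // -[ln _ *+ 2]mulr_natl => H.
have : (1 + t) ^+ 2 * (2 / 3 / (1 + t) + 1 - 2 * (1 + t) + 1 / 3 * (1 + t) ^+ 2)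
   = - (2 * t + 3 * t ^+ 2 + 2 / 3 * t ^+ 3 - t ^+ 4 / 3) by field; lra.
lra.
Qed.

(** * Counting resonant triples of frequencies *)

Lemma sum_open_interval (n lo hi : nat) :
  (\sum_(i < n) (lo < i < hi) <= hi - lo.+1)%N.
Proof.
suff: (\sum_(i < n) (lo < i < hi) <= minn n hi - lo.+1)%N.
  by move/leq_trans; apply; lia.
elim: n => [|n IH]; first by rewrite big_ord0.
rewrite big_ord_recr /=; move: IH; set S := (\sum_(i < n) _)%N.
by case: ifP || case: (boolP (lo < n < hi)%N); lia.
Qed.

(** On an even cycle this says that the frequencies i and j have the same sign,
    with 0 and n/2 counted as having none. *)
Definition same_arc (n i j : nat) : bool :=
  [&& 0 < i, 0 < j, i < n./2 & j < n./2]%N || [&& n./2 < i & n./2 < j]%N.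

Lemma count_dvdn_le1 (n s : nat) (P : pred nat) :
  (\sum_(k < n) ((n %| s + k) && P k) <= 1)%N.
Proof.
have [n0|n0] := posnP n; first by rewrite big1 // => -[k kn]; lia.
have kn : ((n - s %% n) %% n < n)%N by rewrite ltn_mod.
rewrite (bigD1 (Ordinal kn)) //= big1 => [|k]; first by rewrite addn0 leq_b1.
rewrite -val_eqE /= => kk; apply/eqP; rewrite eqb0 negb_and; apply/orP; left.
apply: contra kk => /dvdnP[q e]; apply/eqP.
have e1 := divn_eq s n; have := ltn_ord k; have := ltn_pmod s n0.
move: e1 e; set a := (s %/ n)%N; set r := (s %% n)%N => e1 e rn kn'.
have q_a : (q = a \/ q = a.+1)%N.
  have a_q : (a <= q)%N by rewrite -(leq_pmul2r n0); lia.
  have q_a : (q < a.+2)%N by rewrite -(ltn_pmul2r n0) !mulSn; lia.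
  lia.
have [r0|r0] := posnP r.
  rewrite r0 subn0 modnn; case: q_a e => ->; rewrite ?mulSn; lia.
by rewrite modn_small; [case: q_a e => ->; rewrite ?mulSn; lia|lia].
Qed.

(** For fixed k the condition n | i + j + k determines j from i, and it confines
    i to an open interval on each of the two arcs.  Both intervals contain
    psi_n(k) - 1 integers: on the first arc i + j = n - k with 0 < i, j < n/2, so
    n/2 - k < i < n/2 if k < n/2, and 0 < i < n - k otherwise. *)
Lemma count_same_arc (n k : nat) : ~~ odd n -> (0 < k < n)%N ->
  (\sum_(i < n) \sum_(j < n) ((n %| i + j + k) && same_arc n i j)
   <= 2 * (minn k (n - k)).-1)%N.
Proof.
move=> n_even /andP[k0 kn].
pose lo1 := (n./2 - k)%N; pose hi1 := minn n./2 (n - k).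
pose lo2 := maxn n./2 (n - k); pose hi2 := minn n (n + n./2 - k).
apply: (@leq_trans (\sum_(i < n) ((lo1 < i < hi1) + (lo2 < i < hi2)))%N).
  apply: leq_sum => i _.
  have [|h] := boolP ((lo1 < i < hi1) || (lo2 < i < hi2))%N.
    move=> h; apply: (@leq_trans 1); last by move: h; do 2 case: (_ && _).
    under eq_bigr do rewrite addnAC.
    exact: count_dvdn_le1.
  rewrite big1 // => j _; apply/eqP; rewrite eqb0; apply: contra h.
  case/andP => /dvdnP[q e] a.
  have := ltn_ord i; have := ltn_ord j => jn i_n.
  have q12 : (q = 1 \/ q = 2)%N by move: a; rewrite /same_arc; nia.
  move: a; rewrite /same_arc /lo1 /hi1 /lo2 /hi2.
  by case: q12 e => -> e; lia.
rewrite big_split /=.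
apply: leq_trans (leq_add (sum_open_interval n _ _) (sum_open_interval n _ _)) _.
rewrite /lo1 /hi1 /lo2 /hi2; lia.
Qed.

(** The sum i + j + k is n or 2n.  In the first case two of the three numbers
    are below n/2, since otherwise two would be at least n/2 and the third
    positive; in the second case two are above n/2 by the symmetry i -> n - i. *)
Lemma same_arc_triple (n i j k : nat) : ~~ odd n ->
  (0 < i < n)%N -> (0 < j < n)%N -> (0 < k < n)%N -> (n %| i + j + k)%N ->
  same_arc n i j || same_arc n j k || same_arc n k i.
Proof.
move=> n_even hi hj hk /dvdnP[q e].
have q12 : (q = 1 \/ q = 2)%N by nia.
by rewrite /same_arc; case: q12 e => -> e; lia.
Qed.

Lemma sum3_rot (V : nmodType) (I : finType) (F : I -> I -> I -> V) :
  \sum_i \sum_j \sum_k F i j k = \sum_i \sum_j \sum_k F j k i.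
Proof.
under eq_bigr do rewrite exchange_big /=.
by rewrite exchange_big.
Qed.

(** The sum is L^2 + H^2, with L and H the sums of c over the two arcs; these are
    equal by symmetry and L + H is at most the total sum. *)
Lemma sum_arcs (R : realFieldType) (n : nat) (c : 'I_n -> R) :
  ~~ odd n -> (forall k, 0 <= c k) ->
  (forall i j : 'I_n, (i + j = n)%N -> c i = c j) ->
  \sum_(i < n) \sum_(j < n) (same_arc n i j)%:R * (c i * c j)
  <= (\sum_(k < n) c k) ^+ 2 / 2.
Proof.
case: n c => [|n] c n_even c0 c_sym; first by rewrite !big_ord0 expr0n /= mul0r.
set L := \sum_(i < n.+1) (0 < i < n.+1./2)%N%:R * c i.
set H := \sum_(i < n.+1) (n.+1./2 < i)%N%:R * c i.
have L_H : L = H.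
  rewrite /L (reindex_inj (@oppr_inj _)); apply: eq_bigr => i _ /=.
  have [->|i0] := eqVneq i ord0; first by rewrite /= subn0 modnn !mul0r.
  have {}i0 : (0 < i)%N by rewrite lt0n; apply: contra i0 => /eqP e; apply/eqP/val_inj.
  have i_n := ltn_ord i.
  have ni : ((n.+1 - i) %% n.+1 = n.+1 - i)%N by apply: modn_small; lia.
  rewrite (c_sym (- i) i) /= ni; last by lia.
  by congr ((_ : bool)%:R * _); apply/idP/idP; lia.
have arcs_le : L + H <= \sum_(k < n.+1) c k.
  rewrite -big_split /=; apply: ler_sum => i _; rewrite -mulrDl -natrD.
  rewrite -[leRHS]mul1r ler_wpM2r // (_ : 1 = 1%:R) // ler_nat.
  by case: (boolP (0 < i < n.+1./2)%N); case: (boolP (n.+1./2 < i)%N); lia.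
have -> : \sum_(i < n.+1) \sum_(j < n.+1) (same_arc n.+1 i j)%:R * (c i * c j)
    = L * L + H * H.
  rewrite /L /H !big_distrlr /= -big_split /=; apply: eq_bigr => i _.
  rewrite -big_split /=; apply: eq_bigr => j _.
  rewrite mulrACA [X in _ = _ + X]mulrACA -!natrM -mulrDl -natrD !mulnb.
  congr (_%:R * _); rewrite /same_arc.
  by do ![case: ltnP => ?] => //=; lia.
have L0 : 0 <= L by apply: sumr_ge0 => i _; rewrite mulr_ge0.
rewrite -L_H in arcs_le *; move: (\sum_(k < n.+1) c k) arcs_le => S LS.
have : (L + L) ^+ 2 <= S ^+ 2 by rewrite lerXn2r ?nnegrE //; lra.
by rewrite !expr2; lra.
Qed.

(** Here b stands for the moduli of the Fourier coefficients of a real function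
    of mean zero.  Among the triples that survive, two frequencies share an arc;
    the arithmetic-geometric inequality then separates b_i b_j, which is summed
    freely over the arcs, from b_k, whose multiplicity is the number of pairs
    on the arcs with i + j = - k. *)
Lemma triple_sum_le (R : realFieldType) (n : nat) (b : 'I_n -> R) (N : R) :
  ~~ odd n -> 0 < N -> (forall k, 0 <= b k) ->
  (forall k : 'I_n, k = 0%N :> nat -> b k = 0) ->
  (forall i j : 'I_n, (i + j = n)%N -> b i = b j) ->
  \sum_(i < n) \sum_(j < n) \sum_(k < n)
    (n %| i + j + k)%N%:R * (b i * b j * b k)
  <= 3 / 4 * (\sum_(k < n) b k ^+ 2) ^+ 2 / N
     + 3 * N * \sum_(k < n) (word_length k).-1%:R * b k ^+ 2.
Proof.
move=> n_even N0 b0 b00 b_sym.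
pose q (i j k : 'I_n) : R := ((n %| i + j + k)%N && same_arc n i j)%:R.
pose T := \sum_(i < n) \sum_(j < n) \sum_(k < n) q i j k * (b i * b j * b k).
have b3 i j k : 0 <= b i * b j * b k by rewrite !mulr_ge0.
apply: (@le_trans _ _ (3 * T)).
  have T2 : T = \sum_(i < n) \sum_(j < n) \sum_(k < n)
      q j k i * (b i * b j * b k).
    rewrite /T sum3_rot; do 3 (apply: eq_bigr => ? _); congr (_ * _); ring.
  have T3 : T = \sum_(i < n) \sum_(j < n) \sum_(k < n)
      q k i j * (b i * b j * b k).
    rewrite T2 sum3_rot; do 3 (apply: eq_bigr => ? _); congr (_ * _); ring.
  have -> : 3 * T = T + T + T by ring.
  rewrite {2}T2 {2}T3 /T -!big_split; apply: ler_sum => i _ /=.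
  rewrite -!big_split; apply: ler_sum => j _ /=.
  rewrite -!big_split; apply: ler_sum => k _ /=.
  have [i0|i0] := posnP i; first by rewrite (b00 _ i0) !(mul0r, mulr0) !addr0.
  have [j0|j0] := posnP j; first by rewrite (b00 _ j0) !(mul0r, mulr0) !addr0.
  have [k0|k0] := posnP k; first by rewrite (b00 _ k0) !(mul0r, mulr0) !addr0.
  rewrite -!mulrDl ler_wpM2r // -!natrD ler_nat.
  rewrite (_ : (j + k + i)%N = i + j + k)%N; last by lia.
  rewrite (_ : (k + i + j)%N = i + j + k)%N; last by lia.
  case: (boolP (n %| _)%N) => // d.
  have := @same_arc_triple n i j k n_even.
  rewrite i0 j0 k0 !ltn_ord d => /(_ isT isT isT isT).
  by case: same_arc; case: same_arc; case: same_arc.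
pose S := \sum_(k < n) b k ^+ 2.
pose D := \sum_(k < n) (word_length k).-1%:R * b k ^+ 2.
suff T_le : 2 * T <= S ^+ 2 / 2 / N + N * (2 * D) by rewrite -/S -/D; lra.
have amgm x y : 2 * (x * y) <= x ^+ 2 / N + N * y ^+ 2.
  have : 0 <= (x - N * y) ^+ 2 / N by rewrite divr_ge0 ?sqr_ge0 // ltW.
  have -> : (x - N * y) ^+ 2 / N = x ^+ 2 / N + N * y ^+ 2 - 2 * (x * y).
    by field; lra.
  lra.
apply: (@le_trans _ _ (\sum_(i < n) \sum_(j < n) \sum_(k < n)
    (q i j k * ((b i * b j) ^+ 2 / N) + q i j k * (N * b k ^+ 2)))).
  rewrite /T mulr_sumr; apply: ler_sum => i _; rewrite mulr_sumr.
  apply: ler_sum => j _; rewrite mulr_sumr; apply: ler_sum => k _.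
  by rewrite -mulrDr mulrCA ler_wpM2l.
under eq_bigr do under eq_bigr do rewrite big_split /=.
under eq_bigr do rewrite big_split /=.
rewrite big_split /=; apply: lerD.
  have := @sum_arcs R n (fun k => b k ^+ 2) n_even (fun k => sqr_ge0 _).
  move=> /(_ (fun i j e => congr1 (fun x => x ^+ 2) (b_sym i j e))).
  have iN0 : 0 <= N^-1 by rewrite invr_ge0 ltW.
  rewrite -/S => /(ler_wpM2r iN0).
  apply: le_trans; rewrite mulr_suml; apply: ler_sum => i _.
  rewrite mulr_suml; apply: ler_sum => j _.
  rewrite -mulr_suml exprMn [leLHS]mulrA ler_wpM2r //.
  rewrite ler_wpM2r ?mulr_ge0 ?sqr_ge0 // -natr_sum ler_nat.
  case: same_arc; last by rewrite big1 // => k _; rewrite andbF.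
  exact: (count_dvdn_le1 n (i + j) xpredT).
rewrite sum3_rot /D !mulr_sumr; apply: ler_sum => k _.
have [k0|k0] := posnP k.
  by rewrite (b00 _ k0) expr0n /= !mulr0 big1 // => i _; rewrite big1 // => j _; rewrite mulr0.
under eq_bigr do rewrite -mulr_suml.
rewrite -mulr_suml mulrCA; apply: ler_wpM2l; first exact: ltW.
rewrite mulrA ler_wpM2r ?sqr_ge0 //.
rewrite -natrM; under eq_bigr do rewrite -natr_sum.
rewrite -natr_sum ler_nat; apply: count_same_arc => //.
by rewrite k0 ltn_ord.
Qed.

(** * Averages over Z_n *)

Section Average.
Variables (F : fieldType) (n : nat).
Implicit Types f g : 'I_n -> F.

Lemma eq_avg f g : f =1 g -> avg f = avg g.
Proof. by move=> fg; apply: eq_bigr => x _; rewrite fg. Qed.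

Lemma avgD f g : avg (fun x => f x + g x) = avg f + avg g.
Proof. by rewrite /avg -big_split; apply: eq_bigr => x _; rewrite mulrDl. Qed.

Lemma avgZ c f : avg (fun x => c * f x) = c * avg f.
Proof. by rewrite /avg mulr_sumr; apply: eq_bigr => x _; rewrite mulrA. Qed.

Lemma avg_sum (I : finType) (f : I -> 'I_n -> F) :
  avg (fun x => \sum_i f i x) = \sum_i avg (f i).
Proof. by rewrite /avg exchange_big; apply: eq_bigr => x _; rewrite mulr_suml. Qed.

Lemma avg_cst (c : F) : n%:R != 0 :> F -> avg (fun _ : 'I_n => c) = c.
Proof.
by move=> n0; rewrite /avg -mulr_suml sumr_const card_ord -[c *+ n]mulr_natr mulfK.
Qed.

End Average.

Lemma avg_toC (R : realType) n (f : 'I_n -> R) :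
  (avg f)%:C = avg (fun x => (f x)%:C).
Proof.
rewrite /avg rmorph_sum; apply: eq_bigr => x _.
by rewrite rmorphM fmorphV rmorph_nat.
Qed.

Lemma le_avg (R : realType) n (f g : 'I_n -> R) :
  (forall x, f x <= g x) -> avg f <= avg g.
Proof.
by move=> fg; apply: ler_sum => x _; rewrite ler_wpM2r ?invr_ge0.
Qed.

Lemma avg_ge0 (R : realType) n (f : 'I_n -> R) :
  (forall x, 0 <= f x) -> 0 <= avg f.
Proof. by move=> f0; apply: sumr_ge0 => x _; rewrite mulr_ge0 ?invr_ge0. Qed.

(** * Moduli of the Fourier coefficients *)

Section Spectrum.
Variable R : realType.

Lemma cis2pi_nat (m : nat) : cis (2 * pi * m%:R : R) = 1.
Proof. by rewrite cisM_nat cis2pi expr1n. Qed.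

Lemma chi0 n (k x : 'I_n) : k = 0%N :> nat -> chi R k x = 1.
Proof. by move=> k0; rewrite /chi k0 mulr0n mulr0 !mul0r cis0. Qed.

(** The character of frequency m mod n is orthogonal to the trivial one unless
    n divides m. *)
Lemma avg_cis (n m : nat) : (0 < n)%N ->
  avg (fun x : 'I_n => cis (2 * pi * m%:R * x%:R / n%:R : R)) = (n %| m)%N%:R.
Proof.
move=> n0; have nR : n%:R != 0 :> R by rewrite pnatr_eq0 -lt0n.
pose r : 'I_n := Ordinal (ltn_pmod m n0).
rewrite -[(n %| m)%N]/(r == Ordinal n0) -(chi_orthonormal R).
apply: eq_avg => x; rewrite [chi _ (Ordinal _) _]chi0 // conjc1 mulr1 /chi /=.
rewrite {1}(divn_eq m n) natrD natrM.
have -> : 2 * pi * ((m %/ n)%N%:R * n%:R + (m %% n)%N%:R) * x%:R / n%:R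
    = 2 * pi * (m %/ n * x)%N%:R + 2 * pi * (m %% n)%N%:R * x%:R / n%:R :> R.
  by rewrite natrM; field.
by rewrite cisD cis2pi_nat mul1r.
Qed.

Lemma chi_opp n (i j x : 'I_n) : (i + j = n)%N -> chi R j x = (chi R i x)^*%C.
Proof.
move=> ij; have n0 : (0 < n)%N by apply: leq_ltn_trans (ltn_ord i).
have nR : n%:R != 0 :> R by rewrite pnatr_eq0 -lt0n.
rewrite /chi cisJ.
have -> : 2 * pi * j%:R * x%:R / n%:R
    = 2 * pi * x%:R - 2 * pi * i%:R * x%:R / n%:R :> R.
  have -> : j%:R = n%:R - i%:R :> R by apply/eqP; rewrite eq_sym subr_eq addrC -natrD ij.
  by field.
by rewrite cisD cis2pi_nat mul1r.
Qed.

Definition coef_abs n (f : 'I_n -> R) (k : 'I_n) : R :=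
  Normc.normc (inner (toC f) (chi R k)).

Lemma eq_coef_abs n (f h : 'I_n -> R) k : f =1 h -> coef_abs f k = coef_abs h k.
Proof.
by move=> fh; congr Normc.normc; apply: eq_avg => x; rewrite /toC fh.
Qed.

Lemma coef_absE n (f : 'I_n -> R) k : (coef_abs f k)%:C = `|inner (toC f) (chi R k)|.
Proof. by []. Qed.

Lemma coef_abs_ge0 n (f : 'I_n -> R) k : 0 <= coef_abs f k.
Proof. by rewrite -ler0c coef_absE normr_ge0. Qed.

Lemma coef_abs_opp n (f : 'I_n -> R) (i j : 'I_n) :
  (i + j = n)%N -> coef_abs f i = coef_abs f j.
Proof.
move=> ij; apply: complexI; rewrite !coef_absE -[LHS]normcJ; congr `|_|.
rewrite /inner /avg rmorph_sum; apply: eq_bigr => x _.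
rewrite !(rmorphM (@conjc _)) fmorphV rmorph_nat.
by rewrite (chi_opp x ij); congr (_ * _ / _); exact: (conjc_real (f x)).
Qed.

Lemma inner_Apsi_coef_abs n (f : 'I_n -> R) :
  inner (toC f) (Apsi (toC f))
  = (\sum_(k < n) (word_length k)%:R * coef_abs f k ^+ 2)%:C.
Proof.
rewrite inner_Apsi rmorph_sum; apply: eq_bigr => k _.
by rewrite rmorphM rmorph_nat rmorphXn.
Qed.

Lemma parseval n (f : 'I_n -> R) :
  avg (fun x => f x ^+ 2) = \sum_(k < n) coef_abs f k ^+ 2.
Proof.
apply: complexI; rewrite avg_toC rmorph_sum.
transitivity (\sum_(k < n) (inner (toC f) (chi R k))^*%C
                * inner (toC f) (chi R k)); last first.
  by apply: eq_bigr => k _; rewrite mulrC -sqr_normc [RHS]rmorphXn.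
under [RHS]eq_bigr do rewrite [X in _ * X]/inner -avgZ.
rewrite -avg_sum; apply: eq_avg => x.
transitivity (toC f x * (toC f x)^*%C).
  by rewrite /toC conjc_real expr2 rmorphM.
rewrite {2}(chi_expansion (toC f) x) rmorph_sum mulr_sumr.
by apply: eq_bigr => k _; rewrite rmorphM mulrCA.
Qed.

(** Expanding the cube over the characters leaves only the triples of
    frequencies whose product character is trivial. *)
Lemma avg_cube_le n (f : 'I_n -> R) :
  avg (fun x => f x ^+ 3) <= \sum_(i < n) \sum_(j < n) \sum_(k < n)
    (n %| i + j + k)%N%:R * (coef_abs f i * coef_abs f j * coef_abs f k).
Proof.
case: n f => [|n] f; first by rewrite /avg !big_ord0.
pose a k := inner (toC f) (chi R k).
have cubeE : (avg (fun x => f x ^+ 3))%:C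
    = \sum_(i < n.+1) \sum_(j < n.+1) \sum_(k < n.+1)
        (n.+1 %| i + j + k)%N%:R * (a i * a j * a k).
  rewrite avg_toC.
  transitivity (avg (fun x : 'I_n.+1 =>
      \sum_(i < n.+1) \sum_(j < n.+1) \sum_(k < n.+1)
        (a i * a j * a k) *
        cis (2 * pi * (i + j + k)%N%:R * x%:R / n.+1%:R : R))).
    apply: eq_avg => x; transitivity (toC f x ^+ 3); first by rewrite rmorphXn.
    rewrite exprS expr2 (chi_expansion (toC f) x) mulr_suml; apply: eq_bigr => i _.
    rewrite big_distrlr mulr_sumr; apply: eq_bigr => j _ /=.
    rewrite mulr_sumr; apply: eq_bigr => k _; rewrite !natrD.
    have -> : 2 * pi * (i%:R + j%:R + k%:R) * x%:R / n.+1%:R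
        = 2 * pi * i%:R * x%:R / n.+1%:R + 2 * pi * j%:R * x%:R / n.+1%:R
          + 2 * pi * k%:R * x%:R / n.+1%:R :> R by ring.
    by rewrite !cisD /chi /a; ring.
  rewrite avg_sum; apply: eq_bigr => i _; rewrite avg_sum; apply: eq_bigr => j _.
  rewrite avg_sum; apply: eq_bigr => k _.
  by rewrite avgZ avg_cis // mulrC.
rewrite -lecR; apply: le_trans (real_ler_norm _) _; first by apply/complex_realP; eexists.
rewrite cubeE rmorph_sum; apply: le_trans (ler_norm_sum _ _ _) _.
apply: ler_sum => i _; rewrite rmorph_sum.
apply: le_trans (ler_norm_sum _ _ _) _; apply: ler_sum => j _.
rewrite rmorph_sum; apply: le_trans (ler_norm_sum _ _ _) _.
by apply: ler_sum => k _; rewrite !rmorphM rmorph_nat !normrM normr_nat.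
Qed.

Lemma coef_abs_center n (f : 'I_n -> R) (k : 'I_n) :
  coef_abs (fun x => f x - avg f) k = if k == 0%N :> nat then 0 else coef_abs f k.
Proof.
have n0 : (0 < n)%N by apply: leq_ltn_trans (ltn_ord k).
pose o : 'I_n := Ordinal n0.
have E : inner (toC (fun x => f x - avg f)) (chi R k)
    = inner (toC f) (chi R k) - (avg f)%:C * (o == k)%:R.
  rewrite -(chi_orthonormal R) -mulNr -avgZ -avgD; apply: eq_avg => x.
  by rewrite [chi R o x]chi0 // mul1r /toC rmorphB mulrBl mulNr.
apply: complexI; rewrite coef_absE E.
rewrite -(inj_eq val_inj) /= eq_sym; case: ifP => k0; last first.
  by rewrite mulr0 subr0.
have -> : k = o by apply: val_inj; apply/eqP.
rewrite mulr1 avg_toC [inner _ _](_ : _ = avg (fun x => (f x)%:C)) ?subrr ?normr0 //.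
by apply: eq_avg => x; rewrite chi0 // conjc1 mulr1.
Qed.

End Spectrum.

(** * The inequality for even n *)

Section Inequality.
Variables (R : realType) (n : nat) (f : 'I_n -> R).
Hypothesis n_even : ~~ odd n.
Hypothesis n_gt0 : (0 < n)%N.
Let m := avg f.
Let var := avg (fun x => (f x - m) ^+ 2).
Let energy := \sum_(k < n) (word_length k)%:R * coef_abs f k ^+ 2.

Let nR : n%:R != 0 :> R. Proof. by rewrite pnatr_eq0 -lt0n. Qed.

Lemma avg_sqr_center : avg (fun x => f x ^+ 2) = m ^+ 2 + var.
Proof.
have -> : var = avg (fun x => f x ^+ 2 + ((- 2 * m) * f x + m ^+ 2)).
  by apply: eq_avg => x; ring.
by rewrite !avgD avgZ avg_cst // -/m; ring.
Qed.

Lemma avg_cube_center :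
  avg (fun x => f x ^+ 3)
  = m ^+ 3 + 3 * m * var + avg (fun x => (f x - m) ^+ 3).
Proof.
have -> : avg (fun x => (f x - m) ^+ 3) = avg (fun x => f x ^+ 3
    + ((- 3 * m) * f x ^+ 2 + ((3 * m ^+ 2) * f x + - m ^+ 3))).
  by apply: eq_avg => x; ring.
rewrite !avgD !avgZ avg_cst // -/m avg_sqr_center; ring.
Qed.

(** The excess energy - var is the sum of (psi_n(k) - 1) b_k^2 over the nonzero
    frequencies, by Parseval; with this, it is the estimate of the resonant
    triples. *)
Lemma cube_center_le (N : R) : 0 < N ->
  avg (fun x => (f x - m) ^+ 3) <= 3 / 4 * var ^+ 2 / N + 3 * N * (energy - var).
Proof.
move=> N0; apply: le_trans (avg_cube_le _) _.
set b := coef_abs _.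
have b00 (k : 'I_n) : k = 0%N :> nat -> b k = 0.
  by move=> k0; rewrite /b coef_abs_center k0.
apply: le_trans (triple_sum_le n_even N0 (@coef_abs_ge0 _ _ _) b00 (@coef_abs_opp _ _ _)) _.
rewrite -parseval -/var; suff -> : energy - var
  = \sum_(k < n) (word_length k).-1%:R * b k ^+ 2 by [].
rewrite /var parseval -/b -sumrB; apply: eq_bigr => k _.
rewrite /b coef_abs_center; have [k0|k0] := posnP k.
  by rewrite {1}/word_length k0 min0n expr0n /= !(mul0r, mulr0) subr0.
suff -> : (word_length k)%:R = (word_length k).-1%:R + 1 :> R by ring.
by rewrite natr1 prednK // /word_length; have := ltn_ord k; lia.
Qed.

(** Subtracting ln N^2 inside the average makes f / N the variable of the
    pointwise bound. *)
Lemma entsq_le (N : R) : (forall x, 0 <= f x) -> 0 < N -> normsq f = N ^+ 2 ->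
  entsq f <= 2 / 3 * avg (fun x => f x ^+ 3) / N + 4 / 3 * N ^+ 2 - 2 * m * N.
Proof.
move=> f0 N0 fN.
have sqrE : avg (fun x => f x ^+ 2) = N ^+ 2.
  by rewrite -fN; apply: eq_avg => x; rewrite ger0_norm.
have -> : entsq f = avg (fun x => f x ^+ 2 * ln (f x ^+ 2)
    + - ln (N ^+ 2) * f x ^+ 2).
  by rewrite avgD avgZ sqrE /entsq fN; ring.
apply: (@le_trans _ _ (avg (fun x => (2 / 3 / N) * f x ^+ 3
    + (f x ^+ 2 + (- 2 * N * f x + N ^+ 2 / 3))))).
  apply: le_avg => x; have := sqr_ln_upper N0 (f0 x); lra.
rewrite !avgD !avgZ sqrE avg_cst // -/m le_eqVlt; apply/orP; left; apply/eqP.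
by field; lra.
Qed.

Lemma entsq_le_energy : (forall x, 0 <= f x) -> entsq f <= 2 * energy.
Proof.
move=> f0; have normsqE : normsq f = m ^+ 2 + var.
  by rewrite -avg_sqr_center; apply: eq_avg => x; rewrite ger0_norm.
have m0 : 0 <= m by apply: avg_ge0.
have var0 : 0 <= var by apply: avg_ge0 => x; apply: sqr_ge0.
have energy0 : 0 <= energy.
  by apply: sumr_ge0 => k _; rewrite mulr_ge0 ?sqr_ge0.
have [fz|fnz] := eqVneq (normsq f) 0.
  have f00 x : f x = 0.
    have : normsq f == 0 by rewrite fz.
    rewrite psumr_eq0 => [|y _]; last by rewrite mulr_ge0 ?sqr_ge0 ?invr_ge0.
    move=> /allP /(_ x); rewrite mem_index_enum => /(_ isT) /=.
    by rewrite mulf_eq0 invr_eq0 (negPf nR) orbF expf_eq0 normr_eq0 => /eqP.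
  rewrite /entsq fz mul0r subr0 /avg big1 => [|x _]; first by rewrite mulr_ge0.
  by rewrite f00 expr0n /= !mul0r.
pose N := Num.sqrt (normsq f).
have N2 : N ^+ 2 = m ^+ 2 + var by rewrite sqr_sqrtr normsqE // addr_ge0 ?sqr_ge0.
have N0 : 0 < N by rewrite sqrtr_gt0 lt_def fnz normsqE addr_ge0 ?sqr_ge0.
have mN : m <= N.
  by rewrite -(@ler_pXn2r _ 2) ?nnegrE ?(ltW N0) // N2 lerDl.
apply: le_trans (entsq_le f0 N0 _) _; first by rewrite normsqE.
have := cube_center_le N0; rewrite avg_cube_center.
have -> : var = N ^+ 2 - m ^+ 2 by rewrite N2; ring.
move: (avg _) => tau.
set E := energy => tau_le.
have r0 : 0 < N^-1 by rewrite invr_gt0.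
have {}tau_le : 2 / 3 * tau / N
    <= (N ^+ 2 - m ^+ 2) ^+ 2 / (2 * N ^+ 2) + 2 * (E - (N ^+ 2 - m ^+ 2)).
  have -> : 2 / 3 * tau / N = 2 / 3 * N^-1 * tau by ring.
  have N23 : 0 <= 2 / 3 * N^-1 by lra.
  apply: le_trans (ler_wpM2l N23 tau_le) _.
  by rewrite le_eqVlt; apply/orP; left; apply/eqP; field; lra.
(* Divided by N^2 and with r = m / N, this is (1 - r)^3 (1 + 3 r) / 6, the gap
   left once the cubic average is replaced by its bound. *)
have key : 0 <= (N - m) ^+ 3 * (N + 3 * m) / (6 * N ^+ 2).
  by rewrite divr_ge0 ?mulr_ge0 ?exprn_ge0 ?sqr_ge0 //; lra.
have keyE : (N - m) ^+ 3 * (N + 3 * m) / (6 * N ^+ 2)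
  = 2 * (N ^+ 2 - m ^+ 2) - 4 / 3 * N ^+ 2 + 2 * m * N
    - 2 / 3 * (m ^+ 3 + 3 * m * (N ^+ 2 - m ^+ 2)) / N
    - (N ^+ 2 - m ^+ 2) ^+ 2 / (2 * N ^+ 2) by field; lra.
rewrite keyE in key; lra.
Qed.

End Inequality.

Lemma log_sobolev_even (R : realType) (n : nat) :
  ~~ odd n -> (0 < n)%N -> @log_sobolev R n 2.
Proof.
move=> n_even n_gt0 f f0.
by rewrite inner_Apsi_coef_abs -rmorphM lecR entsq_le_energy.
Qed.

(** * Optimality of the constant 2 *)

Section Optimality.
Variables (R : realType) (n : nat).
Hypothesis n_gt1 : (1 < n)%N.

Let nR : n%:R != 0 :> R. Proof. by rewrite pnatr_eq0; lia. Qed.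
Let o : 'I_n := Ordinal (ltnW n_gt1).
Let u : 'I_n := Ordinal n_gt1.
Let pred_ltn : (n.-1 < n)%N. Proof. by lia. Qed.
Let u' : 'I_n := Ordinal pred_ltn.

Let g (x : 'I_n) : R := cos (2 * pi * x%:R / n%:R).
Let v := avg (fun x => g x ^+ 2).

Lemma inner_cos (k : 'I_n) :
  inner (toC g) (chi R k) = 2^-1 * ((u == k)%:R + (u' == k)%:R).
Proof.
rewrite -!(chi_orthonormal R) -avgD -avgZ; apply: eq_avg => x.
rewrite -mulrDl mulrA; congr (_ * _).
have uu' : (u + u' = n)%N by rewrite /= add1n prednK // ltnW.
rewrite (chi_opp R x uu') addcJ mulrA mulVf ?mul1r ?pnatr_eq0 //.
by rewrite /chi /= mulr1.
Qed.

Lemma avg_cos : avg g = 0.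
Proof.
apply: complexI; rewrite avg_toC.
transitivity (inner (toC g) (chi R o)).
  by apply: eq_avg => x; rewrite chi0 // conjc1 mulr1.
rewrite inner_cos -!val_eqE /= (_ : (n.-1 == 0%N) = false); last by lia.
by rewrite addr0 mulr0.
Qed.

Lemma avg_sqr_cos_gt0 : 0 < v.
Proof.
rewrite /v /avg (bigD1 o) //= /g mulr0n mulr0 mul0r cos0 expr1n mul1r.
apply: ltr_wpDr; last by rewrite invr_gt0 ltr0n ltnW.
by apply: sumr_ge0 => x _; rewrite mulr_ge0 ?sqr_ge0 ?invr_ge0.
Qed.

Lemma avg_sqr_cos_le1 : v <= 1.
Proof.
rewrite -[leRHS](avg_cst 1 nR); apply: le_avg => x.
have := cos_geN1 (2 * pi * x%:R / n%:R : R); have := cos_le1 (2 * pi * x%:R / n%:R : R).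
by rewrite -/(g x) => g1 gm1; nra.
Qed.

(** The perturbation 1 + e cos(2 pi x / n) of the constant function: its nonzero
    frequencies 1 and n - 1, which coincide if n = 2, have word length 1. *)
Variable e : R.
Let f (x : 'I_n) : R := 1 + e * g x.

Lemma avg_perturb : avg f = 1.
Proof. by rewrite avgD avgZ avg_cos mulr0 addr0 avg_cst. Qed.

(** Only frequencies of word length 1 contribute, so the energy is the variance
    of f. *)
Lemma inner_Apsi_perturb : inner (toC f) (Apsi (toC f)) = (e ^+ 2 * v)%:C.
Proof.
have -> : e ^+ 2 * v = \sum_(k < n) coef_abs (fun x => f x - avg f) k ^+ 2.
  rewrite -parseval -avgZ; apply: eq_avg => x; rewrite avg_perturb /f; ring.
rewrite inner_Apsi_coef_abs; congr (_%:C); apply: eq_bigr => k _.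
have [k0|k0] := posnP k.
  by rewrite coef_abs_center k0 /word_length k0 min0n mul0r expr0n.
have sE : coef_abs f k = coef_abs (fun x => f x - avg f) k by rewrite coef_abs_center gtn_eqF.
rewrite sE; have [k1|k1] := eqVneq (word_length k) 1%N; first by rewrite k1 mul1r.
suff -> : coef_abs (fun x => f x - avg f) k = 0 by rewrite expr0n mulr0.
rewrite (@eq_coef_abs _ _ _ (fun x => e * g x)) => [|x]; last first.
  by rewrite avg_perturb /f addrC addKr.
apply: complexI; rewrite coef_absE.
have -> : inner (toC (fun x => e * g x)) (chi R k) = e%:C * inner (toC g) (chi R k).
  by rewrite -avgZ; apply: eq_avg => x; rewrite /toC rmorphM mulrA.
move: k1; rewrite inner_cos /word_length -!val_eqE /= => k1.
have -> : (1%N == k) = false by have := ltn_ord k; lia.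
have -> : (n.-1 == k) = false by have := ltn_ord k; lia.
by rewrite addr0 !mulr0 normr0.
Qed.

(** The average of (1 + t)^2 ln (1 + t)^2 is about 3 e^2 v, of which e^2 v is
    taken back by the logarithm of the norm; the errors are each at most
    e^3 v. *)
Lemma entsq_perturb_ge : 0 < e < 1 -> 2 * e ^+ 2 * v * (1 - e) <= entsq f.
Proof.
move=> /andP[e0 e1]; have v0 := avg_sqr_cos_gt0; have v1 := avg_sqr_cos_le1.
have fN : normsq f = 1 + e ^+ 2 * v.
  transitivity (avg (fun x => 1 + (2 * e * g x + e ^+ 2 * g x ^+ 2))).
    by apply: eq_avg => x; rewrite real_normK ?num_real // /f; ring.
  by rewrite !avgD !avgZ avg_cos avg_cst // mulr0 add0r.
have ev0 : 0 <= e ^+ 2 * v by rewrite mulr_ge0 ?sqr_ge0 // ltW.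
have e21 : e ^+ 2 <= e by rewrite expr2 ger_pMl // ltW.
have ev_e : e ^+ 2 * v <= e.
  by apply: le_trans e21; rewrite ger_pMr // exprn_gt0.
have lnN : normsq f * ln (normsq f) <= e ^+ 2 * v + e ^+ 3 * v.
  have N0 : 0 < normsq f by rewrite fN; lra.
  have ln_le : ln (normsq f) <= e ^+ 2 * v.
    by have := le_ln1Dx (lt_le_trans (@ltrN10 R) ev0); rewrite -fN.
  apply: le_trans (ler_wpM2l (ltW N0) ln_le) _; rewrite fN.
  have -> : (1 + e ^+ 2 * v) * (e ^+ 2 * v) = e ^+ 2 * v + (e ^+ 2 * v) * (e ^+ 2 * v).
    by ring.
  rewrite lerD2l (_ : e ^+ 3 * v = e * (e ^+ 2 * v)); last by ring.
  by rewrite ler_wpM2r.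
have ent_ge : 3 * e ^+ 2 * v - e ^+ 3 * v <= avg (fun x => f x ^+ 2 * ln (f x ^+ 2)).
  apply: (@le_trans _ _ (avg (fun x => 2 * e * g x + (3 * e ^+ 2 - e ^+ 3) * g x ^+ 2))).
    by rewrite avgD !avgZ avg_cos -/v; lra.
  apply: le_avg => x.
  have gm1 : -1 <= g x by apply: cos_geN1.
  have g1 : g x <= 1 by apply: cos_le1.
  have eg : -1 < e * g x by nra.
  apply: le_trans (sqr_ln_lower eg); rewrite !exprMn.
  have eg2 : 0 <= e * (1 - g x ^+ 2).
    by apply: mulr_ge0; [exact: ltW|rewrite expr2; nra].
  (* The difference of the two sides is e^3 g^2 (1 + 2 g / 3 - e g^2 / 3); the
     last factor is split into terms that are nonnegative since |g| <= 1. *)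
  have : 0 <= e ^+ 3 * g x ^+ 2 * ((1 - e) / 3 + 2 / 3 * (1 + g x) + e / 3 * (1 - g x ^+ 2)).
    apply: mulr_ge0; last by lra.
    by apply: mulr_ge0; [rewrite exprn_ge0 ?(ltW e0)|apply: sqr_ge0].
  rewrite !(exprS _ 3, exprS _ 2, exprS _ 1); lra.
rewrite /entsq; move: lnN ent_ge.
lra.
Qed.

End Optimality.

Lemma log_sobolev_optimal (R : realType) (n : nat) (c : R) :
  (1 < n)%N -> c < 2 -> ~ @log_sobolev R n c.
Proof.
move=> n_gt1 c2 lsi; have v0 := avg_sqr_cos_gt0 R n_gt1.
pose e : R := Num.min (1 / 2) ((2 - c) / 4).
have e0 : 0 < e by rewrite lt_min; apply/andP; split; lra.
have e_half : e <= 1 / 2 by rewrite ge_min lexx.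
have e_c : e <= (2 - c) / 4 by rewrite ge_min lexx orbT.
have e1 : 0 < e < 1 by rewrite e0 /=; lra.
have /lsi : forall x : 'I_n, 0 <= 1 + e * cos (2 * pi * x%:R / n%:R).
  move=> x; have := cos_geN1 (2 * pi * x%:R / n%:R : R).
  by move=> cx; nra.
rewrite inner_Apsi_perturb // -rmorphM lecR.
move=> /(le_trans (entsq_perturb_ge n_gt1 e1)).
move: v0; move: (avg _) => v v0.
rewrite (_ : 2 * e ^+ 2 * v * (1 - e) = 2 * (1 - e) * (e ^+ 2 * v)); last by ring.
by rewrite ler_pM2r ?mulr_gt0 ?exprn_gt0 //; lra.
Qed.

Theorem theorem1p2 (R : realType) (n k : nat) (hk : (1 <= k)%N)
    (hn : n = (3 * 2 ^ k)%N \/ n = (2 ^ k)%N) :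
  @log_sobolev R n 2 /\ (forall c : R, c < 2 -> ~ @log_sobolev R n c).
Proof.
have [n_even n_gt1] : ~~ odd n /\ (1 < n)%N.
  case: k hk hn => // k _ hn; have k0 : (0 < 2 ^ k)%N by rewrite expn_gt0.
  by case: hn => ->; rewrite expnS; split; lia.
split; first by apply: log_sobolev_even => //; apply: ltnW.
by move=> c c2; apply: log_sobolev_optimal.
Qed.
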